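(* For every constant $k\in\mathbb{N}$ and every $n\in\mathbb{N}$, there is an $n$-variate real polynomial $P=P_{n,k}$ of total degree $k$ such that the following hold: (1) $P$ can be computed by a $\Sigma\Pi\Sigma$ circuit of size $O(n(\log n)^2)$; (2) any monotone arithmetic circuit computing $P$ has size at least $(n/k)^{\Omega(k)}$.
   Context: A $\Sigma\Pi\Sigma$ circuit (depth-three arithmetic circuit) over $\mathbb{R}$ computes a polynomial of the form $\sum_{i}\prod_{j}\ell_{i,j}$ where each $\ell_{i,j}$ is an affine linear form in the variables; its size is the number of wires/gates. A monotone arithmetic circuit over $\mathbb{R}$ is an arithmetic circuit with $+$ and $\times$ gates whose inputs are variables and nonnegative real constants; its size is its number of gates. *)

(* Defs.v *)
From HB Require Import structures.
From mathcomp Require Import all_boot all_order all_algebra.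
From mathcomp Require Import mpoly.
From mathcomp Require Import reals.
(* [exp] (for [ln] and [powR]) is loaded without Import: the notations of
   mathcomp-analysis clash with those of [mpoly]. *)
From mathcomp Require exp.

Set Implicit Arguments.
Unset Strict Implicit.
Unset Printing Implicit Defensive.

Import Order.TTheory GRing.Theory Num.Theory.
Local Open Scope ring_scope.

Notation ln := exp.ln.
Notation powR := exp.powR.

Record affine_form (R : realType) (n : nat) := AffineForm {
  aff_const : R;
  aff_coef : 'I_n -> R
}.

Definition affine_poly (R : realType) (n : nat) (l : affine_form R n)
    : {mpoly R[n]} :=
  (aff_const l)%:MP + \sum_(i < n) aff_coef l i *: 'X_i.

(* One wire per nonzero coefficient, and one for a nonzero constant term. *)
Definition affine_wires (R : realType) (n : nat) (l : affine_form R n) : nat :=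
  ((aff_const l != 0%R) + \sum_(i < n) (aff_coef l i != 0%R))%N.

(* The bottom gates compute the affine forms [sps_form D i]; each product gate
   is the list of the bottom gates wired to it, so that a bottom gate may feed
   several product gates; the top gate adds up all the product gates. *)
Record sps_circuit (R : realType) (n : nat) := SPSCircuit {
  sps_nforms : nat;
  sps_form : 'I_sps_nforms -> affine_form R n;
  sps_prods : seq (seq 'I_sps_nforms)
}.

Definition sps_poly (R : realType) (n : nat) (D : sps_circuit R n)
    : {mpoly R[n]} :=
  \sum_(p <- sps_prods D) \prod_(j <- p) affine_poly (sps_form j).

Definition sps_wires (R : realType) (n : nat) (D : sps_circuit R n) : nat :=
  (\sum_(i < sps_nforms D) affine_wires (sps_form i)
   + \sum_(p <- sps_prods D) size p
   + size (sps_prods D))%N.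

Definition sps_gates (R : realType) (n : nat) (D : sps_circuit R n) : nat :=
  (sps_nforms D + size (sps_prods D) + 1)%N.

(* Wires and gates are both counted, so that an upper bound on the size bounds
   each of the two. *)
Definition sps_size (R : realType) (n : nat) (D : sps_circuit R n) : nat :=
  (sps_wires D + sps_gates D)%N.

(* A circuit (a DAG of binary gates) is the list of its gates in a topological
   order; [Gate_out j] is the output of the gate of index [j] in that list. *)
Inductive operand (R : realType) (n : nat) :=
| Var of 'I_n
| Const of R
| Gate_out of nat.

Inductive gate (R : realType) (n : nat) :=
| Add_gate of operand R n & operand R n
| Mul_gate of operand R n & operand R n.

Record circuit (R : realType) (n : nat) := Circuit {
  circ_gates : seq (gate R n);
  circ_output : operand R n
}.

Definition operand_poly (R : realType) (n : nat) (vs : seq {mpoly R[n]})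
    (o : operand R n) : {mpoly R[n]} :=
  match o with
  | Var i => 'X_i
  | Const a => a%:MP
  | Gate_out j => vs`_j
  end.

Definition gate_poly (R : realType) (n : nat) (vs : seq {mpoly R[n]})
    (g : gate R n) : {mpoly R[n]} :=
  match g with
  | Add_gate a b => operand_poly vs a + operand_poly vs b
  | Mul_gate a b => operand_poly vs a * operand_poly vs b
  end.

Definition gates_polys (R : realType) (n : nat) (gs : seq (gate R n))
    : seq {mpoly R[n]} :=
  foldl (fun vs g => rcons vs (gate_poly vs g)) [::] gs.

Definition circuit_poly (R : realType) (n : nat) (D : circuit R n)
    : {mpoly R[n]} :=
  operand_poly (gates_polys (circ_gates D)) (circ_output D).

(* The operands of the [i]-th gate are monotone inputs or gates of index less
   than [i]. *)
Definition monotone_operand (R : realType) (n : nat) (i : nat)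
    (o : operand R n) : bool :=
  match o with
  | Var _ => true
  | Const a => 0 <= a
  | Gate_out j => (j < i)%N
  end.

Definition monotone_gate (R : realType) (n : nat) (i : nat) (g : gate R n)
    : bool :=
  match g with
  | Add_gate a b | Mul_gate a b => monotone_operand i a && monotone_operand i b
  end.

Fixpoint monotone_gates (R : realType) (n : nat) (i : nat)
    (gs : seq (gate R n)) : bool :=
  if gs is g :: gs' then monotone_gate i g && monotone_gates i.+1 gs' else true.

Definition monotone_circuit (R : realType) (n : nat) (D : circuit R n) : bool :=
  monotone_gates 0 (circ_gates D) &&
  monotone_operand (size (circ_gates D)) (circ_output D).

(* Inputs (variables and constants) are not counted as gates. *)
Definition circuit_size (R : realType) (n : nat) (D : circuit R n) : nat :=
  size (circ_gates D).

(* Main.v *)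
(* A monotone circuit has no cancellation, so each of its gates contributes to
   the computed polynomial a family of monomials closed under recombination,
   and by descending to the heavier factor at product gates every monomial
   passes through a gate of balanced degree. For a polynomial whose monomials
   choose one variable in each of k blocks, a gate thus fixes a balanced set A
   of blocks, and its monomials can be mixed along A. The size is at least the
   number of suitable monomials divided by the largest mixing-closed family.

   For n large, the choices in the blocks s and t encode subsets of m = O(log n)
   cells attached to the pair (s, t), and the coefficient is
   (1 - number of cells met from both sides)^2. Expanding the square gives
   O(m^2) products of linear forms. Among the configurations without any met
   cell, a mixing-closed family contains no two whose mixture meets in exactly
   one cell, and the Kaibel-Weltge argument for unique disjointness shows that
   it has density at most (2/3)^(number of cells across A).

   For n bounded in terms of k the SPS size does not matter, and a
   Gilbert-Varshamov code of relative distance 2/3 is used: mixing-closed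
   families of codewords are singletons. When moreover k <= 2 or n < 192, it is
   enough that every variable and a constant have to be read. *)
Require Import Defs.
From mathcomp Require Import all_boot all_order all_algebra.
From mathcomp Require Import mpoly.
From mathcomp Require Import reals.
From mathcomp Require sequences.
From mathcomp Require Import zify ring lra.

Set Implicit Arguments.
Unset Strict Implicit.
Unset Printing Implicit Defensive.

Import Order.TTheory GRing.Theory Num.Theory.
Local Open Scope ring_scope.

(** * Families of disjoint pairs without a unique intersection *)

Section Disj.
Variables (E : finType).
Implicit Types (d : {ffun E -> option bool}) (H : {set {ffun E -> option bool}}).

Definition set_at (e : E) (x : option bool) d : {ffun E -> option bool} :=
  [ffun i => if i == e then x else d i].

Definition slice (e : E) (x : option bool) H := [set d | set_at e x d \in H].

(** Double counting of the pairs [(d, x)] with [d] in [H]: exchanging [x] with the value of [d] at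
    [e] is an involution, which sorts the pairs into the three slices. *)
Lemma card_slices e H :
  (#|slice e None H| + #|slice e (Some true) H| + #|slice e (Some false) H|
   = 3 * #|H|)%N.
Proof.
have -> : (3 * #|H| = \sum_(p : {ffun E -> option bool} * option bool) (p.1 \in H))%N.
  rewrite -(pair_bigA _ (fun (d : {ffun E -> option bool}) (_ : option bool) =>
    nat_of_bool (d \in H))) /=.
  rewrite -sum1_card big_distrr /= [in LHS]big_mkcond /=; apply: eq_bigr => d _.
  rewrite sum_nat_const card_option card_bool; by case: (d \in H).
pose swap (p : {ffun E -> option bool} * option bool) := (set_at e p.2 p.1, p.1 e).
have swapK : involutive swap.
  move=> [d x]; rewrite /swap /= ffunE eqxx; congr pair.
  by apply/ffunP=> i; rewrite !ffunE; case: eqP => [->|].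
rewrite (reindex_inj (inv_inj swapK)) /=.
rewrite -(pair_bigA _ (fun d x => nat_of_bool (set_at e x d \in H))) /=.
rewrite exchange_big /= (bigD1 None) //= (bigD1 (Some true)) //= (bigD1 (Some false)) //=.
rewrite [X in (_ + (_ + (_ + X)))%N]big1 => [|[[]|] //]; rewrite addn0.
rewrite addnA -!sum1_card; congr (_ + _ + _)%N;
  by rewrite big_mkcond; apply: eq_bigr => d _; rewrite inE; case: (_ \in _).
Qed.

(* The induction of Kaibel and Weltge for the unique disjointness matrix; on
   [C], [d] encodes the disjoint pair of sets [d e = Some (p e)] and
   [d e = Some (~~ p e)]. *)
Lemma card_no_unique_meet (p : E -> bool) (C : {set E}) H :
  {in H &, forall d d',
     #|[set e in C | (d e == Some (p e)) && (d' e == Some (~~ p e))]| != 1} ->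
  (#|H| * 3 ^ #|C| <= 3 ^ #|E| * 2 ^ #|C|)%N.
Proof.
have [c] := ubnP #|C|; elim: c C H => // c IH C H ltc hH.
have [->|[e eC]] := set_0Vmem C.
  rewrite cards0 !muln1.
  by rewrite (leq_trans (max_card _)) // card_ffun card_option card_bool.
pose C' := C :\ e.
have cC : #|C| = #|C'|.+1 by rewrite (cardsD1 e C) eC.
have meetE d d' x y :
  #|[set i in C | (set_at e x d i == Some (p i)) && (set_at e y d' i == Some (~~ p i))]|
  = ((x == Some (p e)) && (y == Some (~~ p e)) +
    #|[set i in C' | (d i == Some (p i)) && (d' i == Some (~~ p i))]|)%N.
  rewrite (cardsD1 e) inE eC !ffunE eqxx /=; congr (_ + _)%N.
  apply: eq_card => i; rewrite !inE !ffunE; case: eqP => //= _.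
(* Values at [e] taken from [None] and a single [x] cannot meet at [e], so this union inherits the
   hypothesis on [C']. *)
have bound x : x != None ->
    (#|slice e None H :|: slice e x H| * 3 ^ #|C'| <= 3 ^ #|E| * 2 ^ #|C'|)%N.
  move=> x0; apply: IH; first by rewrite -cC.
  move=> d d' dH d'H.
  have {dH} [y hy dH] : exists2 y, (y == None) || (y == x) & set_at e y d \in H.
    by move: dH; rewrite !inE => /orP[] ?; [exists None|exists x]; rewrite ?eqxx ?orbT.
  have {d'H} [z hz d'H] : exists2 y, (y == None) || (y == x) & set_at e y d' \in H.
    by move: d'H; rewrite !inE => /orP[] ?; [exists None|exists x]; rewrite ?eqxx ?orbT.
  have := hH _ _ dH d'H; rewrite meetE.
  suff -> : (y == Some (p e)) && (z == Some (~~ p e)) = false by [].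
  clear -x0 hy hz; move: x0 hy hz.
  by case: (p e); case: x => [[]|]; case: y => [[]|]; case: z => [[]|].
(* A common element, filled at [e] in the two ways, would give two members of [H] that meet in [e]
   alone. *)
have dis : [disjoint slice e (Some true) H & slice e (Some false) H].
  rewrite -setI_eq0; apply/eqP/setP=> d; rewrite !inE; apply/negP=> /andP[h1 h0].
  have hp b : set_at e (Some b) d \in H by case: b.
  have := hH _ _ (hp (p e)) (hp (~~ p e)); rewrite meetE !eqxx /=.
  rewrite (_ : [set i in C' | _] = set0) ?cards0 //.
  apply/setP=> i; rewrite !inE; case: (d i) => [b|]; rewrite ?andbF //.
  by case: b (p i) => [] []; rewrite ?andbF.
have bT := bound (Some true) isT; have bF := bound (Some false) isT.
have h3 := card_slices e H.
have h1 := cardsUI (slice e None H) (slice e (Some true) H).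
have h2 := cardsUI (slice e None H) (slice e (Some false) H).
have h4 : (#|slice e None H :&: slice e (Some true) H| +
       #|slice e None H :&: slice e (Some false) H| <= #|slice e None H|)%N.
  rewrite -cardsUI [X in (_ + #|pred_of_set X|)%N](_ : _ = set0) ?cards0 ?addn0.
    by apply: subset_leq_card; rewrite subUset !subsetIl.
  apply/setP=> d; rewrite !inE; move/setP: (disjoint_setI0 dis) => /(_ d).
  by rewrite !inE; case: (_ \in _); case: (_ \in _); case: (_ \in _).
(* Inclusion-exclusion: the two overlaps with the [None] slice are disjoint, so together they cost
   at most one copy of that slice. *)
have le3 : (3 * #|H| <= #|slice e None H :|: slice e (Some true) H| +
                        #|slice e None H :|: slice e (Some false) H|)%N by lia.
rewrite cC !expnS !(mulnCA _ 2) mul2n -addnn.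
apply: leq_trans (leq_add bT bF).
by rewrite -mulnDl mulnCA mulnA leq_mul2r le3 orbT.
Qed.
End Disj.

(** * Monotone circuits and gates of balanced degree *)

Section Monotone.
Variables (R : realType) (n : nat).
Implicit Types (p q P : {mpoly R[n]}) (m u c : 'X_{1..n}) (o : operand R n).

Definition nonneg_coefs p := forall m, 0 <= p@_m.

Lemma nonneg_coefsD p q :
  nonneg_coefs p -> nonneg_coefs q -> nonneg_coefs (p + q).
Proof. by move=> hp hq m; rewrite mcoeffD addr_ge0. Qed.

Lemma nonneg_coefsM p q :
  nonneg_coefs p -> nonneg_coefs q -> nonneg_coefs (p * q).
Proof.
by move=> hp hq m; rewrite mcoeffM sumr_ge0 // => k _; rewrite mulr_ge0.
Qed.

Lemma nonneg_coefsX m : nonneg_coefs 'X_[m].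
Proof. by move=> m'; rewrite mcoeffX ler0n. Qed.

Lemma mcoeffD_neq0 p q m : nonneg_coefs p -> nonneg_coefs q ->
  ((p + q)@_m != 0) = (p@_m != 0) || (q@_m != 0).
Proof. by move=> hp hq; rewrite mcoeffD paddr_eq0 // negb_and. Qed.

Lemma mcoeffM_neq0P p q m : (p * q)@_m != 0 ->
  exists m1 m2, [/\ m = (m1 + m2)%MM, p@_m1 != 0 & q@_m2 != 0].
Proof.
rewrite -mcoeff_msupp => /msuppM_le /allpairsP[[m1 m2] /= [h1 h2 ->]].
by exists m1, m2; rewrite -!mcoeff_msupp.
Qed.

Lemma mcoeffM_neq0 p q m1 m2 : nonneg_coefs p -> nonneg_coefs q ->
  p@_m1 != 0 -> q@_m2 != 0 -> (p * q)@_(m1 + m2) != 0.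
Proof.
move=> hp hq h1 h2; rewrite mcoeffM psumr_neq0; last first.
  by move=> k _; rewrite mulr_ge0.
apply/hasP.
have lt1 : (mdeg m1 < (mdeg (m1 + m2)).+1)%N by rewrite mdegD ltnS leq_addr.
have lt2 : (mdeg m2 < (mdeg (m1 + m2)).+1)%N by rewrite mdegD ltnS leq_addl.
exists (BMultinom lt1, BMultinom lt2); rewrite ?mem_index_enum //=.
by rewrite eqxx /= mulr_gt0 // lt0r ?h1 ?h2 ?hp ?hq.
Qed.

Lemma gates_polys_rcons (gs : seq (gate R n)) g :
  gates_polys (rcons gs g) =
  rcons (gates_polys gs) (gate_poly (gates_polys gs) g).
Proof. by rewrite /gates_polys -cats1 foldl_cat. Qed.

Lemma size_gates_polys (gs : seq (gate R n)) :
  size (gates_polys gs) = size gs.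
Proof.
by elim/last_ind: gs => // gs g IH; rewrite gates_polys_rcons !size_rcons IH.
Qed.

Lemma monotone_gates_rcons i (gs : seq (gate R n)) g :
  monotone_gates i (rcons gs g) =
  monotone_gates i gs && monotone_gate (i + size gs) g.
Proof.
elim: gs i => [|g' gs IH] i /=; first by rewrite addn0 andbT.
by rewrite IH andbA addnS addSn.
Qed.

Lemma operand_poly_rcons (vs : seq {mpoly R[n]}) v o :
  monotone_operand (size vs) o ->
  operand_poly (rcons vs v) o = operand_poly vs o.
Proof. by case: o => //= j lt_j; rewrite nth_rcons lt_j. Qed.

Lemma gate_poly_rcons (vs : seq {mpoly R[n]}) v g :
  monotone_gate (size vs) g -> gate_poly (rcons vs v) g = gate_poly vs g.
Proof. by case: g => a b /= /andP[ha hb]; rewrite !operand_poly_rcons. Qed.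

Lemma monotone_operand_leq i j o :
  (i <= j)%N -> monotone_operand i o -> monotone_operand j o.
Proof. by case: o => //= l le_ij lt_l; apply: leq_trans lt_l le_ij. Qed.

Lemma monotone_gate_leq i j (g : gate R n) :
  (i <= j)%N -> monotone_gate i g -> monotone_gate j g.
Proof.
by case: g => a b le_ij /= /andP[ha hb]; rewrite !(monotone_operand_leq le_ij).
Qed.

(** Operands point backwards, so values appended later do not affect a gate; the fold becomes a
    recursive equation over the complete list of values. *)
Lemma nth_gates_polys (gs : seq (gate R n)) : monotone_gates 0 gs ->
  forall j, (j < size gs)%N ->
  exists g, monotone_gate j g /\
    (gates_polys gs)`_j = gate_poly (gates_polys gs) g.
Proof.
elim/last_ind: gs => // gs g IH; rewrite monotone_gates_rcons add0n.
move=> /andP[hgs hg] j; rewrite size_rcons gates_polys_rcons ltnS leq_eqVlt.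
case/orP=> [/eqP ->|lt_j].
  exists g; split=> //; rewrite nth_rcons size_gates_polys ltnn eqxx.
  by rewrite gate_poly_rcons // size_gates_polys.
have [g' [hg' E]] := IH hgs j lt_j; exists g'; split=> //.
rewrite nth_rcons size_gates_polys lt_j E gate_poly_rcons //.
by rewrite size_gates_polys; apply: monotone_gate_leq hg'; apply: ltnW.
Qed.

Lemma nonneg_gates_polys (gs : seq (gate R n)) : monotone_gates 0 gs ->
  forall o, monotone_operand (size gs) o ->
  nonneg_coefs (operand_poly (gates_polys gs) o).
Proof.
move=> hgs; move: {-2}(size gs) (leqnn (size gs)).
elim=> [|i IH] le_i [x|a|j] //= lt_ji; try exact: nonneg_coefsX;
  try by move=> m; rewrite mcoeffC mulr_ge0.
have lt_j : (j < size gs)%N by apply: leq_trans le_i.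
have [g [hg ->]] := nth_gates_polys hgs lt_j.
have IHj o : monotone_operand j o ->
    nonneg_coefs (operand_poly (gates_polys gs) o).
  by move/(@monotone_operand_leq _ i _ lt_ji); apply: (IH (ltnW le_i)).
by case: g hg => a b /= /andP[ha hb];
  [apply: nonneg_coefsD | apply: nonneg_coefsM]; apply: IHj.
Qed.

(** [c] stands for the monomial gathered from the other factors on the way from a gate of value [w]
    up to the output. *)
Definition context P (w : {mpoly R[n]}) c := forall u, w@_u != 0 -> P@_(c + u) != 0.

(* Descending from the output to the heavier factor at each product gate halves
   the degree at most, so the walk meets a gate of degree in ]k/3, 2k/3]. *)
Lemma balanced_gate (P : {mpoly R[n]}) (D : circuit R n) k m :
  (2 < k)%N -> monotone_circuit D -> circuit_poly D = P ->
  P@_m != 0 -> (2 * k < 3 * mdeg m)%N ->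
  exists j : 'I_(circuit_size D), exists u c,
    [/\ m = (c + u)%MM, (gates_polys (circ_gates D))`_j@_u != 0,
        context P (gates_polys (circ_gates D))`_j c,
        (k < 3 * mdeg u)%N & (3 * mdeg u <= 2 * k)%N].
Proof.
case: D => gs out k3; rewrite /monotone_circuit /circuit_poly /circuit_size /=.
move=> /andP[hgs hout] EP Pm degm; set vs := gates_polys gs in EP *.
(* Inputs have degree at most 1, so the walk cannot end at one while [3 * mdeg u > k >= 3]. *)
have input_deg o u : (operand_poly vs o)@_u != 0 -> (1 < mdeg u)%N ->
    exists j, o = Gate_out R n j.
  case: o => [x|a|j] /=; last by exists j.
    rewrite mcoeffX; have [<-|_] := eqVneq U_(x)%MM u; last by rewrite eqxx.
    by rewrite mdeg1.
  rewrite mcoeffC; have [->|_] := eqVneq u 0%MM; last by rewrite mulr0 eqxx.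
  by rewrite mdeg0.
suff walk i o u c : (i <= size gs)%N -> monotone_operand i o ->
    (operand_poly vs o)@_u != 0 -> context P (operand_poly vs o) c ->
    m = (c + u)%MM -> (k < 3 * mdeg u)%N ->
    exists j : 'I_(size gs), exists u c,
    [/\ m = (c + u)%MM, vs`_j@_u != 0, context P vs`_j c,
        (k < 3 * mdeg u)%N & (3 * mdeg u <= 2 * k)%N].
  apply: (walk _ out m 0%MM (leqnn _) hout); rewrite ?EP ?add0m //; last by lia.
  by move=> u; rewrite add0m.
elim/ltn_ind: i o u c => i IH o u c le_i ho ou ctx Em degu.
have [j Eo] : exists j, o = Gate_out R n j by apply: (input_deg _ _ ou); lia.
move: ho ou ctx; rewrite {o}Eo /= => lt_ji ou ctx.
have lt_j : (j < size gs)%N by apply: leq_trans le_i; lia.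
have [le_u|lt_u] := leqP (3 * mdeg u) (2 * k).
  by exists (Ordinal lt_j), u, c.
have IHj := IH j lt_ji _ _ _ (ltnW lt_j).
have pos o : monotone_operand j o -> nonneg_coefs (operand_poly vs o).
  by move/(monotone_operand_leq (ltnW lt_j)); apply: nonneg_gates_polys.
have [[a b|a b] [/andP[ha hb] E]] := nth_gates_polys hgs lt_j;
  move: ou ctx; rewrite E /= -/vs => ou ctx.
  move: ou; rewrite mcoeffD_neq0; [|exact: pos..].
  by case/orP=> ou; [apply: (IHj a u c) | apply: (IHj b u c)] => // u' hu';
    apply: ctx; rewrite mcoeffD_neq0 ?hu' ?orbT //; apply: pos.
have [u1 [u2 [Eu h1 h2]]] := mcoeffM_neq0P ou.
(* Here [3 * mdeg u > 2 * k], so the heavier factor still has degree above [k / 3]; the lighter one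
   joins the context. *)
have [le12|lt12] := leqP (mdeg u2) (mdeg u1).
  apply: (IHj a u1 (c + u2)%MM) => //; last by move: lt_u; rewrite Eu mdegD; lia.
    move=> u' hu'; rewrite -addmA [(u2 + _)%MM]addmC.
    by apply: ctx; apply: mcoeffM_neq0 => //; apply: pos.
  by rewrite Em Eu -addmA [(u2 + _)%MM]addmC.
apply: (IHj b u2 (c + u1)%MM) => //; last by move: lt_u; rewrite Eu mdegD; lia.
  move=> u' hu'; rewrite -addmA.
  by apply: ctx; apply: mcoeffM_neq0 => //; apply: pos.
by rewrite Em Eu -addmA.
Qed.
End Monotone.

(** * Polynomials choosing one variable per block *)

Section BlockPoly.
Variables (R : realType) (n : nat) (i0 : 'I_n) (k : nat) (V : finType).
Variable var : 'I_k * V -> 'I_n.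
Hypothesis var_inj : injective var.
Implicit Types (v w z : {ffun 'I_k -> V}) (m u c : 'X_{1..n}).
Implicit Types (h : {ffun 'I_k -> V} -> R) (s : 'I_k).

Definition block_monom v : 'X_{1..n} := (\sum_s U_(var (s, v s)))%MM.

(** The pure power brings the degree up to [e] when there are fewer than [e] blocks. *)
Definition block_poly (e : nat) h : {mpoly R[n]} :=
  \sum_v h v *: 'X_[block_monom v] + 'X_[U_(i0) *+ e].

Definition block_deg s m : nat := \sum_x m (var (s, x)).

Definition mix (A : {set 'I_k}) v w : {ffun 'I_k -> V} :=
  [ffun s => if s \in A then v s else w s].

Lemma block_monom_var v s x : block_monom v (var (s, x)) = (v s == x).
Proof.
rewrite mnm_sumE (bigD1 s) //= big1 => [|t ts].
  by rewrite addn0 mnm1E (inj_eq var_inj) -pair_eqE /= eqxx.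
by rewrite mnm1E (inj_eq var_inj) -pair_eqE /= (negPf ts).
Qed.

Lemma block_monom_le1 v i : (block_monom v i <= 1)%N.
Proof.
have [/existsP[s /eqP <-]|none] := boolP [exists s, var (s, v s) == i].
  by rewrite block_monom_var eqxx.
rewrite mnm_sumE big1 // => s _; rewrite mnm1E.
by apply/eqP; rewrite eqb0; apply: contra none => si; apply/existsP; exists s.
Qed.

Lemma mdeg_block_monom v : mdeg (block_monom v) = k.
Proof.
rewrite mdeg_sum (eq_bigr (fun=> 1%N)) => [|s _]; last by rewrite mdeg1.
by rewrite sum_nat_const card_ord muln1.
Qed.

Lemma block_deg_monom s v : block_deg s (block_monom v) = 1%N.
Proof.
rewrite /block_deg (bigD1 (v s)) //= block_monom_var eqxx big1 // => x.
by rewrite block_monom_var eq_sym => /negPf ->.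
Qed.

Lemma block_degD s m u : block_deg s (m + u) = (block_deg s m + block_deg s u)%N.
Proof. by rewrite -big_split; apply: eq_bigr => x _; rewrite mnmDE. Qed.

Lemma sum_block_deg m : (\sum_s block_deg s m <= mdeg m)%N.
Proof.
rewrite pair_bigA /= mdegE (eq_bigr (fun p => m (var p))); last by case.
rewrite -(big_imset (fun i => m i)); last by move=> ? ? _ _; apply: var_inj.
by rewrite [leqRHS](bigID (mem (var @: predT))) leq_addr.
Qed.

(** Each factor has total block degree at most its degree, and the sums over both factors agree, so
    neither contains a variable outside the blocks. *)
Lemma mdeg_block_deg v u c :
  block_monom v = (c + u)%MM -> mdeg u = \sum_s block_deg s u.
Proof.
move=> E; have := congr1 mdeg E; rewrite mdeg_block_monom mdegD.
have := sum_block_deg u; have := sum_block_deg c.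
suff : (\sum_s block_deg s c + \sum_s block_deg s u = k)%N.
  move: (\sum_s block_deg s c)%N (\sum_s block_deg s u)%N => a b; lia.
rewrite -big_split /= (eq_bigr (fun=> 1%N)) => [|s _].
  by rewrite sum_nat_const card_ord muln1.
by rewrite -block_degD -E block_deg_monom.
Qed.

Lemma block_polyE e h m : (block_poly e h)@_m =
  \sum_v h v * (block_monom v == m)%:R + ((U_(i0) *+ e)%MM == m)%:R.
Proof.
rewrite mcoeffD mcoeffX raddf_sum /=; congr (_ + _).
by apply: eq_bigr => v _; rewrite mcoeffZ mcoeffX.
Qed.

Lemma block_poly_supp e h m : (block_poly e h)@_m != 0 ->
  m = (U_(i0) *+ e)%MM \/ exists2 v, h v != 0 & m = block_monom v.
Proof.
rewrite block_polyE; have [->|ne] := eqVneq (U_(i0) *+ e)%MM m; first by left.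
rewrite addr0; case: (pickP (fun v => (h v != 0) && (block_monom v == m))).
  by move=> v /andP[hv /eqP <-] _; right; exists v.
move=> none; rewrite big1 ?eqxx // => v _.
have := none v; case: (eqVneq (h v) 0) => [->|_ /= ->]; first by rewrite mul0r.
by rewrite mulr0.
Qed.

Section Nonneg.
Variables (e : nat) (h : {ffun 'I_k -> V} -> R).
Hypothesis h_ge0 : forall v, 0 <= h v.

Lemma block_poly_nonneg : nonneg_coefs (block_poly e h).
Proof.
move=> m; rewrite block_polyE addr_ge0 ?ler0n ?sumr_ge0 // => v _.
by rewrite mulr_ge0.
Qed.

Lemma block_poly_monom v :
  h v != 0 -> (block_poly e h)@_(block_monom v) != 0.
Proof.
move=> hv; rewrite block_polyE lt0r_neq0 // (bigD1 v) //= eqxx mulr1 -addrA.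
rewrite ltr_pwDl ?lt0r ?hv ?h_ge0 // addr_ge0 ?ler0n ?sumr_ge0 // => w _.
by rewrite mulr_ge0.
Qed.

Lemma block_poly_power : (block_poly e h)@_(U_(i0) *+ e)%MM != 0.
Proof.
rewrite block_polyE paddr_eq0 ?ler0n ?sumr_ge0 //; last first.
  by move=> w _; rewrite mulr_ge0.
by rewrite eqxx oner_eq0 andbF.
Qed.

Lemma msize_block_poly : (k <= e)%N -> msize (block_poly e h) = e.+1.
Proof.
move=> le_ke; apply/eqP; rewrite eqn_leq; apply/andP; split; last first.
  rewrite -[e in leqLHS]mul1n -(mdeg1 i0) -mdegMn; apply: msize_mdeg_lt.
  by rewrite mcoeff_msupp block_poly_power.
rewrite mmeasureE; apply/bigmax_leqP_seq=> m.
rewrite mcoeff_msupp => /block_poly_supp [->|[v _ ->]] _.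
  by rewrite /= mdegMn mdeg1 mul1n.
by rewrite /= mdeg_block_monom ltnS.
Qed.

(** [u] divides both a multilinear monomial and a power of one variable. Hence the balanced part of
    a block monomial never recombines into the padding power. *)
Lemma power_not_split v u c c' : block_monom v = (c + u)%MM ->
  (c' + u)%MM = (U_(i0) *+ e)%MM -> (mdeg u <= 1)%N.
Proof.
move=> Ev Ep; rewrite mdegE (bigD1 i0) //= big1 => [|i ii0].
  have := block_monom_le1 v i0; rewrite Ev mnmDE addn0; lia.
have := congr1 (fun m : 'X_{1..n} => m i) Ep.
rewrite mnmDE mulmnE mnm1E eq_sym (negPf ii0) mul0n; lia.
Qed.

(** In the blocks of [A] the variable of [z] comes from [u], hence from [v]; in the others it comes
    from [c'], hence from [w]. *)
Lemma mix_of_monom v w z u c u' c' (A : {set 'I_k}) :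
  block_monom v = (c + u)%MM -> block_monom w = (c' + u')%MM ->
  (c' + u)%MM = block_monom z -> A = [set s | block_deg s u == 1%N] ->
  z = mix A v w.
Proof.
move=> Ev Ew Ez ->.
have gt0_mem (m m' : 'X_{1..n}) x s :
    block_monom x = (m + m')%MM -> (0 < block_deg s m')%N ->
    (0 < m' (var (s, x s)))%N.
  move=> E; rewrite /block_deg (bigD1 (x s)) //= big1 ?addn0 // => y ys.
  have := block_monom_var x s y; rewrite E mnmDE eq_sym (negPf ys); lia.
have z_mem (m m' : 'X_{1..n}) x s :
    block_monom z = (m + m')%MM -> (0 < m' (var (s, x)))%N -> z s = x.
  move=> E; have := block_monom_var z s x; rewrite E mnmDE.
  by case: eqP => // _; lia.
apply/ffunP=> s; rewrite ffunE inE; case: eqP => du.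
  by apply: (z_mem c' u _ _ (esym Ez)); apply: (gt0_mem c) => //; rewrite du.
apply: (z_mem u c'); first by rewrite addmC.
apply: (gt0_mem u'); first by rewrite addmC.
have := block_deg_monom s z; rewrite -Ez block_degD.
have := block_deg_monom s v; rewrite Ev block_degD; lia.
Qed.

(** The monomials are grouped by their balanced gate. Any context found at a gate completes all the
    monomials found there, which makes [A] common to the group and the group closed under mixing.
    The ratio [B / b] bounds such a group without division. *)
Lemma block_cover (I : finType) (phi : I -> {ffun 'I_k -> V})
    (D : circuit R n) (b B : nat) :
  (2 < k)%N -> monotone_circuit D -> circuit_poly D = block_poly e h ->
  (forall x, h (phi x) != 0) ->
  (forall (A : {set 'I_k}) (H : {set I}), (k < 3 * #|A|)%N ->
     (3 * #|A| <= 2 * k)%N ->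
     {in H &, forall x y, h (mix A (phi x) (phi y)) != 0} ->
     (#|H| * b <= B)%N) ->
  (#|I| * b <= circuit_size D * B)%N.
Proof.
move=> k3 monoD ED h_phi closedB.
pose w (j : 'I_(circuit_size D)) := (gates_polys (circ_gates D))`_j.
have /fin_all_exists[J hJ] (x : I) : exists j, exists u c,
    [/\ block_monom (phi x) = (c + u)%MM, (w j)@_u != 0,
        context (block_poly e h) (w j) c, (k < 3 * mdeg u)%N
      & (3 * mdeg u <= 2 * k)%N].
  apply: balanced_gate => //; first exact: block_poly_monom.
  by rewrite mdeg_block_monom; lia.
suff fib j : (#|[set x | J x == j]| * b <= B)%N.
  rewrite -sum1_card (partition_big J predT) //= big_distrl /=.
  rewrite -[leqRHS](_ : \sum_(j < circuit_size D) B = _)%N; last first.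
    by rewrite sum_nat_const card_ord.
  apply: leq_sum => j _; apply: leq_trans (fib j).
  by rewrite sum1_card leq_mul2r; apply/orP; right; rewrite cardsE.
have [->|[x0]] := set_0Vmem [set x | J x == j]; first by rewrite cards0.
rewrite inE => /eqP J0; have [u0 [c0]] := hJ x0.
rewrite J0 => -[E0 s0 ctx0 lo hi].
have mixed u v c c' : block_monom v = (c + u)%MM -> (k < 3 * mdeg u)%N ->
    (w j)@_u != 0 -> context (block_poly e h) (w j) c' ->
    exists2 z, h z != 0 & (c' + u)%MM = block_monom z.
  move=> Ev du su /(_ u su) /block_poly_supp [Ep|//].
  by have := power_not_split Ev Ep; lia.
(* [c0] completes both [u] and [u0] to block monomials, so in each block both have degree 1 minus
   that of [c0]. *)
have deg_eq u v c s : block_monom v = (c + u)%MM -> (k < 3 * mdeg u)%N ->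
    (w j)@_u != 0 -> block_deg s u = block_deg s u0.
  move=> Ev du su; have [z _ Ez] := mixed _ _ _ _ Ev du su ctx0.
  have := block_deg_monom s z; rewrite -Ez block_degD.
  have := block_deg_monom s (phi x0); rewrite E0 block_degD; lia.
pose A := [set s | block_deg s u0 == 1%N].
have cA : #|A| = mdeg u0.
  rewrite (mdeg_block_deg E0) -sum1_card big_mkcond; apply: eq_bigr => s _.
  rewrite inE; have := block_deg_monom s (phi x0); rewrite E0 block_degD.
  by case: eqP; lia.
apply: (closedB A); rewrite ?cA // => x y; rewrite !inE => /eqP Jx /eqP Jy.
have [u [c]] := hJ x; have [u' [c']] := hJ y; rewrite Jx Jy.
move=> [Ey _ ctxy _ _] [Ex sx _ lox _].
have [z hz Ez] := mixed _ _ _ _ Ex lox sx ctxy.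
rewrite -(mix_of_monom Ex Ey Ez) //; apply/setP=> s; rewrite !inE.
by rewrite (deg_eq _ _ _ _ Ex).
Qed.
End Nonneg.
End BlockPoly.

(** * Constructions of depth-three circuits *)

Section SPSCircuits.
Variables (R : realType) (n : nat).

Definition sps_of (T : finType) (F : T -> affine_form R n) (ps : seq (seq T)) :
    sps_circuit R n :=
  @SPSCircuit R n #|T| (fun j => F (enum_val j)) (map (map enum_rank) ps).

Lemma sps_of_poly (T : finType) (F : T -> affine_form R n) (ps : seq (seq T)) :
  sps_poly (sps_of F ps) = \sum_(p <- ps) \prod_(t <- p) affine_poly (F t).
Proof.
rewrite /sps_poly /= big_map; apply: eq_bigr => p _.
by rewrite big_map; apply: eq_bigr => t _; rewrite enum_rankK.
Qed.

Lemma sps_of_size (T : finType) (F : T -> affine_form R n) (ps : seq (seq T)) :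
  sps_size (sps_of F ps) =
  (\sum_t affine_wires (F t) + \sum_(p <- ps) size p + size ps +
   (#|T| + size ps + 1))%N.
Proof.
rewrite /sps_size /sps_wires /sps_gates /= !size_map big_map.
congr (_ + _ + _ + _)%N; last by apply: eq_bigr => p _; rewrite size_map.
rewrite (reindex enum_rank) /=; last first.
  by exists enum_val => t _; rewrite ?enum_rankK ?enum_valK.
by apply: eq_bigr => t _; rewrite enum_rankK.
Qed.

Definition var_form (i : 'I_n) : affine_form R n :=
  AffineForm 0 (fun j => (j == i)%:R).

Definition const_form (a : R) : affine_form R n := AffineForm a (fun=> 0).

Lemma var_formE i : affine_poly (var_form i) = 'X_i.
Proof.
rewrite /affine_poly /= mpolyC0 add0r (bigD1 i) //= eqxx scale1r big1 ?addr0 //.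
by move=> j /negPf ->; rewrite scale0r.
Qed.

Lemma const_formE a : affine_poly (const_form a) = a%:MP.
Proof. by rewrite /affine_poly big1 ?addr0 // => i _; rewrite scale0r. Qed.

Lemma affine_wires_var i : affine_wires (var_form i) = 1%N.
Proof.
rewrite /affine_wires /= eqxx (bigD1 i) //= eqxx oner_eq0 big1 // => j /negPf ->.
by rewrite eqxx.
Qed.

(** One product gate per monomial, with its coefficient as a constant form. The size is
    uncontrolled, which suffices for the finitely many [n] absorbed by the constant. *)
Lemma sps_exists (P : {mpoly R[n]}) : exists D : sps_circuit R n, sps_poly D = P.
Proof.
pose N := size (msupp P); pose m (j : 'I_N) := nth 0%MM (msupp P) j.
pose F (t : 'I_n + 'I_N) :=
  match t with inl i => var_form i | inr j => const_form P@_(m j) end.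
pose factors (j : 'I_N) := inr j :: flatten [seq nseq (m j i) (inl i) | i <- enum 'I_n].
exists (sps_of F [seq factors j | j <- enum 'I_N]); rewrite sps_of_poly big_map.
rewrite [RHS]mpolyE (big_nth 0%MM) big_mkord big_enum /=; apply: eq_bigr => j _.
rewrite big_cons /= const_formE mul_mpolyC; congr (_ *: _).
rewrite big_flatten big_map big_enum /= mpolyXE_id; apply: eq_bigr => i _.
by rewrite big_nseq var_formE iter_mulr_1.
Qed.

Section BlockCircuit.
Variables (i0 : 'I_n) (k e : nat) (V : finType) (var : 'I_k * V -> 'I_n).
Variables (F : finType) (chi : F -> 'I_k -> V -> R).

Definition block_form (s : 'I_k) (g : V -> R) : affine_form R n :=
  AffineForm 0 (fun i => \sum_x g x * (var (s, x) == i)%:R).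

Lemma block_formE s g :
  affine_poly (block_form s g) = \sum_x g x *: 'X_(var (s, x)).
Proof.
rewrite /affine_poly /= mpolyC0 add0r.
under eq_bigr do rewrite scaler_suml.
rewrite exchange_big /=; apply: eq_bigr => x _.
rewrite (bigD1 (var (s, x))) //= eqxx mulr1 big1 ?addr0 // => i /negPf.
by rewrite eq_sym => ->; rewrite mulr0 scale0r.
Qed.

Lemma affine_wires_block s g : (affine_wires (block_form s g) <= #|V|)%N.
Proof.
rewrite /affine_wires /= eqxx add0n -sum1_card.
apply: (@leq_trans (\sum_i \sum_x (var (s, x) == i))%N).
  apply: leq_sum => i _; case: (eqVneq (\sum_x g x * (var (s, x) == i)%:R) 0) => //= ne0.
  rewrite lt0n sum_nat_eq0; apply: contra_neqN ne0 => /forallP none.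
  by rewrite big1 // => x _; move: (none x) => /=; rewrite eqb0 => /negPf ->; rewrite mulr0.
rewrite exchange_big /=; apply: leq_sum => x _.
by rewrite (bigD1 (var (s, x))) //= eqxx big1 // => i /negPf; rewrite eq_sym => ->.
Qed.

(** Each [f] contributes a coefficient that factors over the blocks; distributivity turns its sum
    over [v] into a single product of [k] linear forms. *)
Lemma block_sps :
  exists2 D : sps_circuit R n,
    sps_poly D = block_poly i0 var e (fun v => \sum_f \prod_s chi f s (v s)) &
    (sps_size D <= #|F| * (k * #|V|) + 2 * (#|F| * k) + 2 * #|F| + e + 6)%N.
Proof.
pose form (t : F * 'I_k + 'I_1) :=
  if t is inl (f, s) then block_form s (chi f s) else var_form i0.
(* The first product is the padding power, [inr ord0] naming the form of the variable [i0]. *)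
pose ps : seq (seq (F * 'I_k + 'I_1)) :=
  nseq e (inr ord0) :: [seq [seq inl (f, s) | s <- enum 'I_k] | f <- enum F].
exists (sps_of form ps).
  rewrite sps_of_poly big_cons big_nseq var_formE addrC /block_poly; congr (_ + _).
    rewrite big_map big_enum /=.
    under [RHS]eq_bigr do rewrite scaler_suml.
    rewrite exchange_big /=; apply: eq_bigr => f _.
    rewrite big_map big_enum /=.
    under eq_bigr do rewrite block_formE.
    rewrite bigA_distr_bigA /=; apply: eq_bigr => v _.
    by rewrite scaler_prod mprodXE.
  by rewrite iter_mulr_1 mpolyXn.
rewrite sps_of_size /= size_map -cardE big_cons size_nseq big_map big_enum /=.
rewrite [X in (_ + (_ + X) + _ + _)%N](eq_bigr (fun=> k)) => [|f _];
  last by rewrite size_map -cardE card_ord.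
rewrite sum_nat_const card_sum card_prod !card_ord.
suff : (\sum_t affine_wires (form t) <= 1 + #|F| * (k * #|V|))%N.
  set W := (\sum_t _)%N; rewrite (_ : #|(fun=> true) : pred F| = #|F|) //.
  by move: W #|F| #|V| => W f x; lia.
rewrite big_sumType /= big_ord1 affine_wires_var addnC leq_add2l.
rewrite -[k in leqRHS]card_ord -!sum_nat_const pair_bigA.
by apply: leq_sum => -[f s] _; apply: affine_wires_block.
Qed.
End BlockCircuit.
End SPSCircuits.

(** * A polynomial that forces every kind of input to be read *)

Section LowPoly.
Variables (R : realType) (n : nat) (i0 : 'I_n).
Implicit Types (m : 'X_{1..n}) (gs : seq (gate R n)) (D : circuit R n).

(** All constants form one kind, so that there are [n + 1] kinds of input; the outer [None] marks a
    gate output. *)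
Definition input_kind (o : operand R n) : option (option 'I_n) :=
  match o with
  | Var i => Some (Some i)
  | Const _ => Some None
  | Gate_out _ => None
  end.

Definition gate_kinds (g : gate R n) : seq (option (option 'I_n)) :=
  match g with
  | Add_gate a b | Mul_gate a b => [:: input_kind a; input_kind b]
  end.

Definition input_kinds gs := flatten (map gate_kinds gs).

Lemma size_input_kinds gs : size (input_kinds gs) = (2 * size gs)%N.
Proof.
elim: gs => //= g gs IH; rewrite /input_kinds /= size_cat -/(input_kinds gs) IH.
by rewrite mulnS; case: g.
Qed.

(** Once the inputs read have their monomials in a set closed under products, so do all the
    gates. *)
Lemma unused_input_kind (kind : option 'I_n) (T : pred 'X_{1..n}) gs :
  (forall m1 m2, T m1 -> T m2 -> T (m1 + m2)%MM) ->
  (kind != None -> T 0%MM) -> (forall i, kind != Some i -> T U_(i)%MM) ->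
  Some kind \notin input_kinds gs ->
  forall j m, (gates_polys gs)`_j@_m != 0 -> T m.
Proof.
move=> TD T0 TU; elim/last_ind: gs => [|gs g IH].
  (* An index beyond the list reads the default polynomial 0, whose support is empty. *)
  by move=> _ j m; rewrite nth_nil mcoeff0 eqxx.
rewrite /input_kinds map_rcons flatten_rcons mem_cat negb_or => /andP[hgs hg] j m.
rewrite gates_polys_rcons nth_rcons.
case: ltnP => _; first exact: IH.
case: ifP => _; last by rewrite mcoeff0 eqxx.
have operandT o m' : Some kind != input_kind o ->
    (operand_poly (gates_polys gs) o)@_m' != 0 -> T m'.
  case: o => [i|a|l] /= ne; last exact: IH.
    by rewrite mcoeffX; have [<-|_] := eqVneq U_(i)%MM m'; rewrite ?eqxx // => _; apply: TU.
  by rewrite mcoeffC; have [->|_] := eqVneq m' 0%MM; rewrite ?mulr0 ?eqxx // => _; apply: T0.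
case: g hg => a b /=; rewrite !inE negb_or => /andP[ha hb].
  rewrite mcoeffD => h; case: (eqVneq (operand_poly (gates_polys gs) a)@_m 0) => [E|].
    by apply: (operandT b) => //; rewrite E add0r in h.
  exact: operandT.
move=> /mcoeffM_neq0P[m1 [m2 [-> h1 h2]]].
by apply: TD; [apply: (operandT a)|apply: (operandT b)].
Qed.

Definition low_poly (e : nat) : {mpoly R[n]} :=
  1 + \sum_i 'X_i + 'X_[U_(i0) *+ e].

Lemma low_polyE e m : (low_poly e)@_m =
  (m == 0%MM)%:R + \sum_i (U_(i)%MM == m)%:R + ((U_(i0) *+ e)%MM == m)%:R.
Proof.
rewrite !mcoeffD mcoeffX mcoeff1 raddf_sum /=; congr (_ + _ + _).
by apply: eq_bigr => i _; rewrite mcoeffX.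
Qed.

Lemma low_poly_nonneg e : nonneg_coefs (low_poly e).
Proof. by move=> m; rewrite low_polyE !addr_ge0 ?sumr_ge0. Qed.

Lemma low_poly0 e : (low_poly e)@_0 != 0.
Proof.
by rewrite low_polyE eqxx -addrA lt0r_neq0 // ltr_pwDl // addr_ge0 ?sumr_ge0.
Qed.

Lemma low_polyU e i : (low_poly e)@_U_(i) != 0.
Proof.
rewrite low_polyE lt0r_neq0 // ltr_pwDl //.
by rewrite ltr_wpDl // (bigD1 i) //= eqxx ltr_pwDl ?sumr_ge0.
Qed.

Lemma msize_low_poly e : (0 < e)%N -> msize (low_poly e) = e.+1.
Proof.
move=> e0; apply/eqP; rewrite eqn_leq; apply/andP; split; last first.
  rewrite -[e in leqLHS]mul1n -(mdeg1 i0) -mdegMn; apply: msize_mdeg_lt.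
  by rewrite mcoeff_msupp low_polyE eqxx lt0r_neq0 // ltr_wpDl // addr_ge0 ?sumr_ge0.
rewrite mmeasureE; apply/bigmax_leqP_seq=> m + _.
rewrite mcoeff_msupp low_polyE; apply: contraNT; rewrite -leqNgt => lt_e.
have dm u : (mdeg u <= e)%N -> (u == m) = false.
  by move=> le_u; apply/eqP=> E; move: lt_e; rewrite /= -E; lia.
rewrite (eq_sym m) !dm ?mdegMn ?mdeg1 ?mdeg0 ?mul1n // big1 ?addr0 ?eqxx // => i _.
by rewrite dm ?mdeg1.
Qed.

Lemma low_poly_sps e :
  exists2 D : sps_circuit R n, sps_poly D = low_poly e &
    (sps_size D = n + e + 10)%N.
Proof.
pose form b := if b then AffineForm (1 : R) (fun=> 1) else var_form R i0.
exists (sps_of form [:: [:: true]; nseq e false]).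
  rewrite sps_of_poly !big_cons !big_nil big_nseq var_formE iter_mulr_1 mpolyXn.
  rewrite mulr1 addr0 /affine_poly /= mpolyC1; congr (_ + _ + _).
  by apply: eq_bigr => i _; rewrite scale1r.
rewrite sps_of_size !big_cons big_nil size_nseq /= big_bool /= affine_wires_var.
rewrite /affine_wires /= oner_eq0 sum_nat_const card_ord card_bool; rewrite /= muln1; lia.
Qed.

(** A binary gate reads at most two of the [n + 1] kinds, and each kind has to be read. *)
Lemma low_poly_lb e D : circuit_poly D = low_poly e ->
  (n.+1 <= 2 * circuit_size D)%N.
Proof.
case: D => gs out; rewrite /circuit_poly /circuit_size /= => E.
have [j Eo] : exists j, out = Gate_out R n j.
  case: out E => [x|a|j] /= E; last by exists j.
    have := low_poly0 e; rewrite -E mcoeffX.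
    by have [Ex|_] := eqVneq U_(x)%MM 0%MM; rewrite ?eqxx //;
      have := mdeg1 x; rewrite Ex mdeg0.
  have := low_polyU e i0; rewrite -E mcoeffC.
  by have [Ex|_] := eqVneq U_(i0)%MM 0%MM; rewrite ?mulr0 ?eqxx //;
    have := mdeg1 i0; rewrite Ex mdeg0.
move: E; rewrite {}Eo /= => E.
suff all_kinds (kind : option 'I_n) : Some kind \in input_kinds gs.
  rewrite -size_input_kinds -[n in leqLHS]card_ord -card_option cardE -(size_map Some).
  apply: uniq_leq_size; first by rewrite map_inj_uniq ?enum_uniq // => ? ? [].
  by move=> ? /mapP[kind _ ->].
(* If [X_i] is never read, no gate has a monomial containing it; if no constant is read, no gate has
   a constant term. *)
apply: contraT => unused; case: kind unused => [i|] unused.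
  have := @unused_input_kind _ (fun m => m i == 0%N) _ _ _ _ unused j U_(i)%MM.
  rewrite E low_polyU mnm1E eqxx; apply=> //.
  - by move=> m1 m2; rewrite mnmDE => /eqP -> /eqP ->.
  - by rewrite mnm0E.
  - by move=> l; rewrite mnm1E eqb0; apply: contraNN => /eqP ->.
have := @unused_input_kind _ (fun m => m != 0%MM) _ _ _ _ unused j 0%MM.
rewrite E low_poly0 eqxx; apply=> //.
- by move=> m1 m2; rewrite -!mdeg_eq0 mdegD; lia.
- by move=> l _; rewrite -mdeg_eq0 mdeg1.
Qed.
End LowPoly.

(** * Codes of relative distance above 2/3 *)

Lemma leq_card_bigcup (I T : finType) (P : pred I) (F : I -> {set T}) :
  (#|\bigcup_(i | P i) F i| <= \sum_(i | P i) #|F i|)%N.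
Proof.
elim/big_ind2: _ => [|A a B b leA leB|//]; first by rewrite cards0.
by apply: leq_trans (leq_add leA leB); rewrite leq_card_setU.
Qed.

Section Code.
Variables (k q : nat).
Implicit Types (x y : {ffun 'I_k -> 'I_q}).

Definition agree x y : {set 'I_k} := [set s | x s == y s].

(** Distance is expressed by agreement sets because a mixture of two words agrees with one on [A]
    and with the other off [A]. *)
Definition is_code (C : {set {ffun 'I_k -> 'I_q}}) : bool :=
  [forall x in C, forall y in C, (k <= 3 * #|agree x y|)%N ==> (x == y)].

Lemma is_codeP (C : {set {ffun 'I_k -> 'I_q}}) : reflect
  {in C &, forall x y, (k <= 3 * #|agree x y|)%N -> x = y} (is_code C).
Proof.
apply: (iffP forall_inP) => [hC x y xC yC le|hC x xC].
  by apply/eqP; have /forall_inP/(_ y yC)/implyP := hC x xC; apply.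
by apply/forall_inP=> y yC; apply/implyP=> le; apply/eqP/hC.
Qed.

Lemma card_agree_on y (T : {set 'I_k}) :
  #|[set x | T \subset agree x y]| = (q ^ (k - #|T|))%N.
Proof.
rewrite (_ : [set x | _] =
    [set x in family (fun s : 'I_k => if s \in T then pred1 (y s) else predT)]).
  rewrite cardsE card_family foldrE big_map big_enum /=.
  rewrite (bigID (mem T)) /= big1 => [|s sT]; last by rewrite sT card1.
  rewrite mul1n (eq_bigr (fun=> q)) => [|s /negPf ->]; last by rewrite card_ord.
  rewrite prod_nat_const; congr (_ ^ _)%N.
  by have := cardC T; rewrite card_ord => /(congr1 (subn^~ #|T|)); rewrite addKn.
apply/setP=> x; rewrite !inE; apply/subsetP/familyP => hx s.
  by case sT: (s \in T); have := hx s; rewrite sT ?inE // => /(_ isT).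
by move=> sT; have := hx s; rewrite sT !inE.
Qed.

(* Gilbert-Varshamov *)
Lemma large_code j : (k <= 3 * j)%N -> (j <= k)%N -> (3 * j < k + 3)%N ->
  (64 <= q)%N ->
  exists2 C, is_code C & (q ^ j <= #|C| ^ 2)%N.
Proof.
move=> kj jk jk3 q64.
have [C /maxsetP[codeC maxC]] : {C | maxset is_code C}.
  by apply: ex_maxset; exists set0; apply/is_codeP=> x y; rewrite inE.
exists C => //.
(* By maximality: a word far from every codeword could be added to [C]. *)
have cover x : exists2 y, y \in C & (k <= 3 * #|agree x y|)%N.
  have [xC|xC] := boolP (x \in C).
    by exists x => //; rewrite (_ : agree x x = setT) ?cardsT ?card_ord; [lia|];
      apply/setP=> s; rewrite !inE eqxx.
  apply/exists_inP; apply: contraNT xC; rewrite negb_exists_in => /forall_inP far.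
  have agreeC z y : agree z y = agree y z by apply/setP=> s; rewrite !inE eq_sym.
  rewrite -(maxC (x |: C)) ?subsetUr ?setU11 //.
  apply/is_codeP=> z y; rewrite !inE => /predU1P[->|zC] /predU1P[->|yC] // le.
  - by move: (far y yC); rewrite le.
  - by move: (far z zC); rewrite agreeC le.
  - by move/is_codeP: codeC; apply.
(* A word is determined by a nearby codeword, a set of agreement, which has at least [j] positions,
   and its values elsewhere. *)
have le_card : (q ^ k <= #|C| * (2 ^ k * q ^ (k - j)))%N.
  rewrite -{1}[k]card_ord -{1}[q]card_ord -card_ffun -cardsT.
  have /leq_trans -> // : (#|[set: {ffun 'I_k -> 'I_q}]| <= #|\bigcup_(y in C)
      \bigcup_(T : {set 'I_k} | (k <= 3 * #|T|)%N) [set x | T \subset agree x y]|)%N.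
    apply/subset_leq_card/subsetP=> x _; have [y yC le] := cover x.
    by apply/bigcupP; exists y => //; apply/bigcupP; exists (agree x y) => //; rewrite inE.
  apply: leq_trans (leq_card_bigcup _ _) _; rewrite -sum_nat_const.
  apply: leq_sum => y _; apply: leq_trans (leq_card_bigcup _ _) _.
  rewrite -[k in (2 ^ k)%N]card_ord -cardsT -card_powerset -sum_nat_const.
  rewrite [leqRHS](bigID (fun T : {set 'I_k} => k <= 3 * #|T|)%N) /=.
  rewrite (eq_bigl (fun T : {set 'I_k} => (T \in powerset setT) && (k <= 3 * #|T|)%N)).
    apply: leq_trans (leq_addr _ _); apply: leq_sum => T /andP[_ le].
    by rewrite card_agree_on leq_pexp2l; lia.
  by move=> T; rewrite powersetE subsetT.
have q0 : (0 < q)%N by lia.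
have le1 : (q ^ j <= #|C| * 2 ^ k)%N.
  by rewrite -(leq_pmul2r (_ : 0 < q ^ (k - j)))%N ?expn_gt0 ?q0 // -expnD subnKC // -mulnA.
have le2 : (2 ^ k <= 2 ^ (3 * j))%N by rewrite leq_exp2l.
(* The bound 64 on the alphabet comes from here: [2 ^ k] is then at most the square root of
   [q ^ j]. *)
have le3 : ((2 ^ (3 * j)) ^ 2 <= q ^ j)%N.
  rewrite (_ : (2 ^ (3 * j)) ^ 2 = (2 ^ 6) ^ j)%N; last by rewrite -!expnM; congr expn; lia.
  by case: (posnP j) => [->|j0] //; rewrite leq_exp2r.
have : (0 < q ^ j)%N by rewrite expn_gt0 q0.
move: (q ^ j)%N (2 ^ k)%N (2 ^ (3 * j))%N #|C| le1 le2 le3 => a b c d le1 le2 le3 a0.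
rewrite -(leq_pmul2r a0) (leq_trans (leq_mul le1 le1)) // mulnACA mulnn.
by rewrite leq_mul2l (leq_trans _ le3) ?orbT // mulnn leq_exp2r.
Qed.
End Code.

(** * The polynomial built from unique disjointness *)

Section DisjointnessPoly.
Variables (R : realType) (n : nat) (i0 : 'I_n) (k m : nat).

(* Block [s] chooses the first sides of the cells [(s, t, l)] and the second
   sides of the cells [(t, s, l)]. *)
Notation V := {ffun 'I_k * 'I_m -> bool * bool}.
Notation E := ('I_k * 'I_k * 'I_m)%type.
Implicit Types (v : {ffun 'I_k -> V}) (d : {ffun E -> option bool}).

Definition meets v (e : E) : bool :=
  (v e.1.1 (e.1.2, e.2)).1 && (v e.1.2 (e.1.1, e.2)).2.

Definition disj_coef v : R := (1 - \sum_e (meets v e)%:R) ^+ 2.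

(** The factor that block [s] contributes to one term of [1 - \sum_e (meets v e)%:R]: [None] is the
    term 1, and the sign of the term of [e] is carried by the first side. *)
Definition disj_term (f : option E) (s : 'I_k) (x : V) : R :=
  if f is Some e then
    (if s == e.1.1 then - (x (e.1.2, e.2)).1%:R else 1) *
    (if s == e.1.2 then (x (e.1.1, e.2)).2%:R else 1)
  else 1.

Lemma disj_termE f v : \prod_s disj_term f s (v s) =
  if f is Some e then - (meets v e)%:R else 1.
Proof.
case: f => [e|] /=; last by rewrite big1.
rewrite big_split /= -!big_mkcond !big_pred1_eq /meets.
by case: (_.1); case: (_.2); rewrite /= ?mulr1 ?mulr0 ?oppr0 ?mul0r.
Qed.

Lemma disj_coefE v : disj_coef v =
  \sum_(f : option E * option E) \prod_s (disj_term f.1 s (v s) * disj_term f.2 s (v s)).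
Proof.
have sumE : 1 - \sum_e (meets v e)%:R = \sum_f \prod_s disj_term f s (v s) :> R.
  under [RHS]eq_bigr do rewrite disj_termE.
  rewrite (bigD1 None) //= (reindex_omap Some id) => [|[]//].
  by rewrite -sumrN; congr (_ + _); apply: eq_bigl => e; rewrite /= eqxx.
rewrite /disj_coef expr2 sumE big_distrlr pair_bigA.
by apply: eq_bigr => f _; rewrite big_split.
Qed.

Lemma disj_coef_neq0 v :
  (disj_coef v != 0) = (#|[set e | meets v e]| != 1%N).
Proof.
rewrite /disj_coef sqrf_eq0 subr_eq0 eq_sym -natr_sum pnatr_eq1.
by rewrite -sum1dep_card [X in _ = (X != _)]big_mkcond.
Qed.

(** Disjoint pairs of sets of cells: each cell is held by at most one of its two sides. *)
Definition split_cells d : {ffun 'I_k -> V} :=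
  [ffun s => [ffun tl => (d (s, tl.1, tl.2) == Some true,
                          d (tl.1, s, tl.2) == Some false)]].

Definition cut (A : {set 'I_k}) : {set E} :=
  [set e | (e.1.1 \in A) != (e.1.2 \in A)].

Lemma meets_split d e : meets (split_cells d) e = false.
Proof.
case: e => [[s t] l]; rewrite /meets !ffunE /=.
by case: (d _) => [[]|].
Qed.

(** Off the cut both sides of a cell come from the same configuration and do not meet; across it,
    one comes from [d] and the other from [d']. *)
Lemma meets_mix (A : {set 'I_k}) d d' (e : E) :
  meets (mix A (split_cells d) (split_cells d')) e =
  [&& e \in cut A, d e == Some (e.1.1 \in A) & d' e == Some (~~ (e.1.1 \in A))].
Proof.
case: e => [[s t] l]; rewrite /meets inE !ffunE /=.
case: (s \in A); case: (t \in A); rewrite !ffunE /= ?andbT //.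
- by case: (d _) => [[]|].
- by rewrite andbC.
- by case: (d' _) => [[]|].
Qed.

Lemma card_cut (A : {set 'I_k}) : #|cut A| = (2 * (#|A| * (k - #|A|)) * m)%N.
Proof.
have cC : #|~: A| = (k - #|A|)%N by rewrite cardsCs setCK card_ord.
have -> : cut A = setX (setX A (~: A) :|: setX (~: A) A) setT.
  by apply/setP=> -[[s t] l]; rewrite !inE /=; case: (s \in A); case: (t \in A).
rewrite cardsX cardsT card_ord cardsU !cardsX cC.
rewrite (_ : _ :&: _ = set0) ?cards0 ?subn0.
  by rewrite [((k - _) * _)%N]mulnC addnn mul2n.
by apply/setP=> -[s t]; rewrite !inE /=; case: (s \in A); case: (t \in A).
Qed.

Variable var : 'I_k * V -> 'I_n.
Hypothesis var_inj : injective var.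

Lemma disj_poly_lb (D : circuit R n) e (c := (k * (k %/ 3) * m)%N) :
  (2 < k)%N -> monotone_circuit D ->
  circuit_poly D = block_poly i0 var e disj_coef ->
  (3 ^ c <= circuit_size D * 2 ^ c)%N.
Proof.
move=> k3 monoD ED.
pose N := #|{: E}|.
have : (#|{: {ffun E -> option bool}}| * 3 ^ c <= circuit_size D * (3 ^ N * 2 ^ c))%N.
  apply: (block_cover var_inj _ k3 monoD ED (phi := split_cells)).
  - by move=> v; rewrite sqr_ge0.
  - move=> d; rewrite disj_coef_neq0 (_ : [set e | _] = set0) ?cards0 //.
    by apply/setP=> f; rewrite !inE meets_split.
  move=> A H lo hi mixH.
  have le_c : (c <= #|cut A|)%N.
    have [b Eb] : exists b, k = (#|A| + b)%N by exists (k - #|A|)%N; lia.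
    have le_div := leq_divM k 3.
    have t_le : (k * (k %/ 3) * 3 <= k * k)%N by rewrite -mulnA leq_mul2l le_div orbT.
    (* Balance means that neither of [#|A|] and [b] exceeds twice the other, whence the nonnegative
       product below. *)
    have ab : (2 * (k * k) <= 9 * (#|A| * b))%N.
      move: Eb lo hi; move: #|A| => a -> lo hi.
      have : (0 <= (2 * a%:Z - b%:Z) * (2 * b%:Z - a%:Z))%R by apply: mulr_ge0; lia.
      nia.
    rewrite card_cut /c leq_mul2r (_ : (k - #|A|)%N = b); last by lia.
    by apply/orP; right; lia.
  have : (#|H| * 3 ^ #|cut A| <= 3 ^ N * 2 ^ #|cut A|)%N.
    apply: (card_no_unique_meet (p := fun e => e.1.1 \in A)) => d d' dH d'H.
    have := mixH _ _ dH d'H; rewrite disj_coef_neq0.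
    by congr (_ != _); apply: eq_card => f; rewrite [LHS]inE [RHS]inE meets_mix.
  (* The density bound for the whole cut is weakened to the exponent [c], which is common to all
     [A]. *)
  rewrite -(subnK le_c) !expnD.
  have : (2 ^ (#|cut A| - c) <= 3 ^ (#|cut A| - c))%N.
    by case: (#|cut A| - c)%N => // x; rewrite leq_exp2r.
  have : (0 < 2 ^ (#|cut A| - c))%N by rewrite expn_gt0.
  move: (3 ^ c)%N (2 ^ c)%N (2 ^ (#|cut A| - c))%N (3 ^ (#|cut A| - c))%N (3 ^ N)%N #|H|.
  move=> a b x y z h x0 xy le.
  rewrite -(leq_pmul2r x0); apply: leq_trans (_ : h * (y * a) <= _)%N; last by nia.
  by rewrite -mulnA leq_mul2l mulnC leq_mul2r xy !orbT.
rewrite card_ffun card_option card_bool mulnCA leq_pmul2l ?expn_gt0 //.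
Qed.

Lemma disj_poly_sps e :
  exists2 D : sps_circuit R n, sps_poly D = block_poly i0 var e disj_coef &
    (sps_size D <= (k * k * m).+1 ^ 2 * (k * #|{: V}| + 2 * k + 2) + e + 6)%N.
Proof.
pose chi (f : option E * option E) s x := disj_term f.1 s x * disj_term f.2 s x.
have [D ED le_D] := block_sps i0 e var chi.
exists D; first by rewrite ED /block_poly; congr (_ + _); apply: eq_bigr => v _;
  rewrite disj_coefE.
apply: leq_trans le_D _; rewrite card_prod card_option !card_prod !card_ord.
move: #|_| (k * k * m)%N => x y; nia.
Qed.

End DisjointnessPoly.

(** * Lower bound from codes *)

Section CodePoly.
Variables (R : realType) (n : nat) (i0 : 'I_n) (k q : nat).
Variable var : 'I_k * 'I_q -> 'I_n.
Hypothesis var_inj : injective var.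

(** A mixture that is a codeword agrees with each parent on at least a third of the blocks, so it
    equals both, and a mixing-closed family has at most one element. *)
Lemma code_poly_lb (C : {set {ffun 'I_k -> 'I_q}}) e (D : circuit R n) :
  (2 < k)%N -> is_code C -> monotone_circuit D ->
  circuit_poly D = block_poly i0 var e (fun v => (v \in C)%:R) ->
  (#|C| <= circuit_size D)%N.
Proof.
move=> k3 /is_codeP codeC monoD ED.
have neq0 v : ((v \in C)%:R != 0 :> R) = (v \in C) by rewrite pnatr_eq0 eqb0 negbK.
rewrite -card_sig -[#|_|]muln1 -[circuit_size D]muln1.
apply: (block_cover var_inj _ k3 monoD ED (phi := val)) => [v|x|A H lo hi mixH].
- by rewrite ler0n.
- by rewrite neq0; apply: (valP x).
rewrite muln1; apply/card_le1_eqP => x y xH yH; apply/val_inj.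
have mC : mix A (val x) (val y) \in C by rewrite -neq0 mixH.
have -> : val x = mix A (val x) (val y).
  apply: codeC => //; first exact: valP.
  apply: (@leq_trans (3 * #|A|)); first exact: ltnW.
  rewrite leq_mul2l; apply/subset_leq_card/subsetP=> s sA.
  by rewrite inE ffunE sA.
apply: codeC => //; first exact: valP.
apply: (@leq_trans (3 * #|~: A|)).
  by rewrite cardsCs setCK card_ord; lia.
rewrite leq_mul2l; apply/subset_leq_card/subsetP=> s; rewrite !inE => sA.
by rewrite ffunE (negPf sA).
Qed.
End CodePoly.

Lemma injection_ord (T : finType) n :
  (#|T| <= n)%N -> exists f : T -> 'I_n, injective f.
Proof.
move=> le_n; exists (fun x => widen_ord le_n (enum_rank x)) => x y.
by move/(congr1 val) => /= /ord_inj /enum_rank_inj.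
Qed.

(** * Numerical estimates for the lower bounds *)

Section Analysis.
Variable R : realType.
Implicit Types (k n s : nat).
Local Notation expR := sequences.expR.

(** The tightest constraint is [rate <= 1 / 384], which arises both for [n < 192] and for codes with
    [n < 64 * k]. *)
Definition rate : R := 400^-1.

Definition target n k : R := powR (n%:R / k%:R) (rate * k%:R).

(** From [x <= expR x] at [x = n / k]; the bound is uniform in [k]. *)
Lemma target_le_expR n k : (0 < k)%N -> target n k <= expR (rate * n%:R).
Proof.
move=> k0; have k0R : 0 < k%:R :> R by rewrite ltr0n.
have -> : rate * n%:R = n%:R / k%:R * (rate * k%:R).
  by rewrite [RHS]mulrC -mulrA [k%:R * _]mulrC divfK // gt_eqF.
rewrite exp.expRM; apply: exp.ge0_ler_powR.
- by rewrite mulr_ge0 ?invr_ge0.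
- by rewrite nnegrE divr_ge0.
- by rewrite nnegrE exp.expR_ge0.
- by apply: le_trans (exp.expR_ge1Dx _); rewrite lerDr.
Qed.

Lemma expR_half : expR (2^-1 : R) <= 2.
Proof.
have := exp.expR_ge1Dx (- 2^-1 : R); rewrite exp.expRN => h.
rewrite -[leLHS]invrK -[leRHS]invrK lef_pV2 ?posrE ?invr_gt0 ?exp.expR_gt0 //.
by apply: le_trans h; lra.
Qed.

Lemma expR_nat n : expR (n%:R : R) <= 4 ^+ n.
Proof.
rewrite -[n%:R]mulr1 exp.expRM_natl; apply: lerXn2r; rewrite ?nnegrE ?exp.expR_ge0 //.
have -> : 1 = 2%:R * 2^-1 :> R by lra.
rewrite exp.expRM_natl expr2; have := expR_half; have := exp.expR_ge0 (2^-1 : R); nra.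
Qed.

Lemma ln_ge_half n : (1 < n)%N -> 2^-1 <= ln (n%:R : R).
Proof.
move=> n1; rewrite -exp.ler_expR exp.lnK ?posrE ?ltr0n; last by lia.
by apply: le_trans expR_half _; rewrite ler_nat.
Qed.

Lemma target_le1 n k : (n <= k)%N -> (0 < k)%N -> target n k <= 1.
Proof.
move=> le_nk k0; have <- : powR 1 (rate * k%:R) = 1 by rewrite exp.powR1.
apply: exp.ge0_ler_powR; rewrite ?nnegrE ?divr_ge0 ?mulr_ge0 ?invr_ge0 //.
by rewrite ler_pdivrMr ?ltr0n // mul1r ler_nat.
Qed.

Lemma target_low n k s : (0 < n)%N -> (0 < k)%N -> (k <= 2)%N || (n < 192)%N ->
  (n.+1 <= 2 * s)%N -> target n k <= s%:R.
Proof.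
move=> n0 k0 + le_s; case/orP=> [k2|n192].
  have n1 : 1 <= n%:R :> R by rewrite ler1n.
  (* For [k <= 2] the exponent is at most 1/2, and the square root of [n] is at most
     [(n + 1) / 2]. *)
  apply: (@le_trans _ _ (powR (n%:R : R) 2^-1)).
    apply: (@le_trans _ _ (powR (n%:R : R) (rate * k%:R))).
      apply: exp.ge0_ler_powR; rewrite ?nnegrE ?divr_ge0 ?mulr_ge0 ?invr_ge0 //.
      by rewrite ler_pdivrMr ?ltr0n // ler_peMr // ler1n.
    apply: exp.ler_powR => //.
    have : k%:R <= 2 :> R by rewrite ler_nat.
    by rewrite /rate; lra.
  rewrite exp.powR12_sqrt //.
  have := sqr_sqrtr (ler0n R n); have := sqrtr_ge0 (n%:R : R).
  have : n%:R + 1 <= 2 * s%:R :> R by rewrite -natrM natr1 ler_nat.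
  nra.
have [n1|n1] := leqP n 1.
  apply: le_trans (target_le1 _ k0) _; first by lia.
  by rewrite ler1n; lia.
apply: le_trans (target_le_expR _ k0) _.
apply: (@le_trans _ _ 2); last by rewrite ler_nat; lia.
apply: le_trans expR_half; rewrite exp.ler_expR.
have : n%:R <= 192 :> R by rewrite ler_nat ltnW.
by rewrite /rate; lra.
Qed.

Lemma target_sqr n k : target n k ^+ 2 = powR (n%:R / k%:R) (rate * k%:R * 2).
Proof. by rewrite exp.powRrM exp.powR_mulrn ?exp.powR_ge0. Qed.

Lemma target_code n k j s (b := minn k (n %/ 64)) (q := (n %/ b)%N) :
  (0 < k)%N -> (192 <= n)%N -> (b <= 3 * j)%N -> (q ^ j <= s ^ 2)%N ->
  target n k <= s%:R.
Proof.
move=> k0 n192 bj le_s; rewrite -ler_sqr ?nnegrE ?exp.powR_ge0 //.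
apply: (@le_trans _ _ ((q ^ j)%:R)); last by rewrite -natrX ler_nat.
have b0 : (0 < b)%N by rewrite /b; lia.
have q64 : (64 <= q)%N by rewrite leq_divRL // /b; lia.
have lt_n : (n < b * q.+1)%N by rewrite mulnC ltn_ceil.
have q1 : 1 <= q%:R :> R by rewrite ler1n; lia.
have bjR : b%:R <= 3 * j%:R :> R by rewrite -natrM ler_nat.
(* If [b = k], then [n / k <= q ^ 2], which compensates the rounding in [q]. *)
have [le_k|lt_k] := leqP k (n %/ 64).
  have Eb : b = k by apply/minn_idPl.
  rewrite target_sqr.
  apply: (@le_trans _ _ (powR (powR (q%:R : R) 2%:R) (rate * k%:R * 2))).
    apply: exp.ge0_ler_powR; rewrite ?nnegrE ?divr_ge0 ?mulr_ge0 ?invr_ge0 ?exp.powR_ge0 //.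
    rewrite exp.powR_mulrn // ler_pdivrMr ?ltr0n // -natrX -natrM ler_nat.
    by rewrite -Eb; nia.
  rewrite -exp.powRrM natrX -exp.powR_mulrn //; apply: exp.ler_powR => //.
  by move: bjR (ler0n R j); rewrite Eb /rate; lra.
(* Otherwise [n <= 384 * j], and the squared target is at most [expR (2 * j)], hence at most
   [16 ^ j]. *)
have Eb : b = (n %/ 64)%N by apply/minn_idPr; rewrite ltnW.
apply: (@le_trans _ _ (expR (rate * n%:R) ^+ 2)).
  by rewrite ler_sqr ?nnegrE ?exp.powR_ge0 ?exp.expR_ge0 // target_le_expR.
rewrite -exp.expRM_natl.
apply: (@le_trans _ _ (expR ((2 * j)%:R : R))).
  rewrite exp.ler_expR.
  have : (n <= 384 * j)%N by lia.
  by rewrite -(ler_nat R) !natrM /rate; have := ler0n R j; lra.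
apply: le_trans (expR_nat _) _.
rewrite -natrX ler_nat expnM; case: (posnP j) => [->//|j0].
by rewrite leq_exp2r //; lia.
Qed.

Lemma target_disj n k m s (c := (k * (k %/ 3) * m)%N) :
  (2 < k)%N -> (0 < m)%N -> (n <= k * (4 ^ k) ^ m.+1)%N ->
  (3 ^ c <= s * 2 ^ c)%N -> target n k <= s%:R.
Proof.
move=> k3 m0 le_n le_s.
(* The factor 5 absorbs the rounding in [k %/ 3]; equality holds at [k = 5]. *)
have le_c : (k * k * m <= 5 * c)%N.
  by rewrite /c mulnA leq_mul2r mulnCA leq_mul2l; apply/orP; right; apply/orP; right; lia.
have k0R : 0 < k%:R :> R by rewrite ltr0n; lia.
apply: (@le_trans _ _ ((3 / 2) ^+ c)); last first.
  by rewrite expr_div_n ler_pdivrMr ?exprn_gt0 // -!natrX -natrM ler_nat.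
apply: (@le_trans _ _ (powR (powR (4 : R) (2 * (k * m)%:R)) (rate * k%:R))).
  apply: exp.ge0_ler_powR; rewrite ?nnegrE ?divr_ge0 ?mulr_ge0 ?invr_ge0 ?exp.powR_ge0 //.
  rewrite -natrM exp.powR_mulrn // ler_pdivrMr // -natrX -natrM ler_nat.
  apply: leq_trans le_n _; rewrite mulnC leq_mul2r -expnM leq_exp2l //.
  by apply/orP; right; nia.
rewrite -exp.powRrM.
(* The base changes from 4 to 3/2 through [(3 / 2) ^ 4 = 81 / 16 >= 4]. *)
apply: (@le_trans _ _ (powR (powR (3 / 2 : R) 4%:R) (2 * (k * m)%:R * (rate * k%:R)))).
  apply: exp.ge0_ler_powR; rewrite ?nnegrE ?divr_ge0 ?mulr_ge0 ?invr_ge0 ?exp.powR_ge0 //.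
  rewrite exp.powR_mulrn //; last by lra.
  by rewrite !exprS expr0; lra.
rewrite -exp.powRrM -exp.powR_mulrn; last by lra.
apply: exp.ler_powR; first by lra.
have : (k * k * m)%:R <= (5 * c)%:R :> R by rewrite ler_nat.
by have := ler0n R c; rewrite !natrM /rate; lra.
Qed.

End Analysis.

(** * The ranges of [n] and [k], and their combination *)

Section Regimes.
Variable R : realType.
Implicit Types (k n : nat) (C : R).

Definition hard_poly k n (P : {mpoly R[n]}) : Prop :=
  [/\ msize P = k.+1, nonneg_coefs P &
    forall D : circuit R n, monotone_circuit D -> circuit_poly D = P ->
      target R n k <= (circuit_size D)%:R].

(** The upper bound asks for [1 < n] since [ln 1 = 0] while every size is positive. *)
Definition separation k n C : Prop :=
  exists2 P : {mpoly R[n]}, hard_poly k P &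
    (1 < n)%N -> exists2 D : sps_circuit R n, sps_poly D = P &
      (sps_size D)%:R <= C * (n%:R * ln (n%:R : R) ^+ 2).

Lemma separation_le k n C C' : C <= C' -> separation k n C -> separation k n C'.
Proof.
move=> le_C [P hP sps]; exists P => // n1; have [D ED le_D] := sps n1.
by exists D => //; apply: le_trans le_D _; rewrite ler_wpM2r // mulr_ge0 ?sqr_ge0.
Qed.

(** For a single [n] any circuit will do: its size is absorbed into the constant. *)
Lemma separation_of_hard k n (P : {mpoly R[n]}) :
  hard_poly k P -> exists C, separation k n C.
Proof.
move=> hP; have [D ED] := sps_exists P.
exists ((sps_size D)%:R / (n%:R * ln (n%:R : R) ^+ 2)), P => // n1; exists D => //.
have ln_gt0 : 0 < ln (n%:R : R) by apply: lt_le_trans _ (ln_ge_half R n1); rewrite invr_gt0.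
by rewrite divfK // gt_eqF // mulr_gt0 ?exprn_gt0 // ltr0n ltnW.
Qed.

Lemma low_hard k n (i0 : 'I_n) : (0 < k)%N -> (k <= 2)%N || (n < 192)%N ->
  hard_poly k (low_poly R i0 k).
Proof.
move=> k0 low; split; [exact: msize_low_poly|exact: low_poly_nonneg|].
move=> D _ ED; apply: target_low => //; first exact: leq_ltn_trans (ltn_ord i0).
exact: low_poly_lb ED.
Qed.

Lemma low_separation k n : (0 < n)%N -> (0 < k)%N -> (k <= 2)%N ->
  separation k n 52.
Proof.
case: n => // n _ k0 k2; exists (low_poly R ord0 k); first by apply: low_hard; rewrite ?k2.
move=> n1; have [D ED size_D] := low_poly_sps R (ord0 : 'I_n.+1) k; exists D => //.
have := ln_ge_half R n1; move: (ln _) => l hl.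
(* The constant 52 is 13 times 4, since the squared logarithm is at least 1/4. *)
have : ((sps_size D)%:R <= 13 * n.+1%:R :> R).
  by rewrite -natrM ler_nat size_D; lia.
move/le_trans; apply; rewrite mulrCA [13 * _]mulrC ler_wpM2l //.
nra.
Qed.

Lemma code_hard k n : (2 < k)%N -> (192 <= n)%N ->
  exists P : {mpoly R[n]}, hard_poly k P.
Proof.
(* As many blocks as possible, up to [k], subject to an alphabet of at least 64 letters; the padding
   power makes up for missing blocks. *)
move=> k3 n192; pose b := minn k (n %/ 64); pose q := (n %/ b)%N.
have b3 : (2 < b)%N by rewrite /b; lia.
have q64 : (64 <= q)%N by rewrite leq_divRL // /b; lia.
have [var var_inj] : exists f : 'I_b * 'I_q -> 'I_n, injective f.
  by apply: injection_ord; rewrite card_prod !card_ord mulnC leq_divM.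
have i0 : 'I_n by apply: (@Ordinal n 0); lia.
have [C codeC le_C] : exists2 C : {set {ffun 'I_b -> 'I_q}}, is_code C &
    (q ^ ((b + 2) %/ 3) <= #|C| ^ 2)%N.
  by apply: large_code => //; lia.
exists (block_poly i0 var k (fun v => (v \in C)%:R)); split.
- by apply: msize_block_poly; rewrite ?geq_minl // => v; rewrite ler0n.
- by apply: block_poly_nonneg => v; rewrite ler0n.
move=> D monoD ED; apply: (@target_code _ _ _ ((b + 2) %/ 3)); rewrite -/b -/q //; try lia.
apply: leq_trans le_C _; rewrite leq_exp2r //.
exact: code_poly_lb codeC monoD ED.
Qed.

Lemma disj_separation k n : (2 < k)%N -> (k * 4 ^ k <= n)%N ->
  separation k n (27 * k%:R ^+ 4).
Proof.
(* The largest [m] for which the [k * 4 ^ (k * m)] block variables fit into [n]; the threshold on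
   [n] makes it positive. *)
move=> k3 le_n; pose m := trunc_log (4 ^ k) (n %/ k).
have k0 : (0 < k)%N by lia.
have k4 : (1 < 4 ^ k)%N by rewrite -(expn0 4) ltn_exp2l.
have le_q : (4 ^ k <= n %/ k)%N by rewrite leq_divRL // mulnC.
have q0 : (0 < n %/ k)%N by apply: leq_trans le_q; rewrite ltnW.
have m0 : (0 < m)%N by rewrite trunc_log_max // expn1.
have le_m : (k * (4 ^ k) ^ m <= n)%N.
  by rewrite mulnC -leq_divRL // trunc_logP.
have lt_m : (n <= k * (4 ^ k) ^ m.+1)%N.
  by rewrite ltnW // mulnC -ltn_divLR // trunc_log_ltn.
have cV : #|{: {ffun 'I_k * 'I_m -> bool * bool}}| = ((4 ^ k) ^ m)%N.
  by rewrite card_ffun !card_prod card_bool !card_ord -expnM.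
have [var var_inj] :
    exists f : 'I_k * {ffun 'I_k * 'I_m -> bool * bool} -> 'I_n, injective f.
  by apply: injection_ord; rewrite card_prod cV card_ord.
have kn : (k <= n)%N by apply: leq_trans le_m; rewrite leq_pmulr // expn_gt0 ltnW.
have i0 : 'I_n by apply: (@Ordinal n 0); lia.
have h_ge0 v : 0 <= disj_coef R v :> R by rewrite sqr_ge0.
exists (block_poly i0 var k (@disj_coef R k m)); first split.
- exact: msize_block_poly.
- exact: block_poly_nonneg.
- move=> D monoD ED; refine (target_disj _ k3 m0 lt_m _).
  exact: disj_poly_lb ED.
move=> n1; have [D ED le_D] := disj_poly_sps R i0 var k; exists D => //.
have m_ln : m%:R <= ln (n%:R : R).
  rewrite -exp.ler_expR exp.lnK ?posrE ?ltr0n; last by lia.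
  apply: le_trans (expR_nat R m) _; rewrite -natrX ler_nat.
  apply: leq_trans le_m; rewrite -expnM.
  by apply: leq_trans (leq_pmull _ k0); rewrite leq_exp2l // leq_pmull.
have : (sps_size D <= 27 * k ^ 4 * (n * m ^ 2))%N.
  apply: leq_trans le_D _; rewrite cV.
  (* The constant 27 is 20 + 7: the square gives [4 * 5], and the padding with the constant gates
     gives 7. *)
  apply: (@leq_trans ((2 * (k * k * m)) ^ 2 * (5 * n) + 7 * n)).
    by rewrite -addnA leq_add ?leq_mul ?leq_exp2r //; nia.
  have : (0 < k ^ 4 * m ^ 2)%N by rewrite muln_gt0 !expn_gt0 k0 m0.
  have -> : ((2 * (k * k * m)) ^ 2 = 4 * (k ^ 4 * m ^ 2))%N by rewrite !expnS !expn0; ring.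
  rewrite -mulnA [(n * _)%N]mulnC [(k ^ 4 * _)%N]mulnA.
  move: (k ^ 4 * m ^ 2)%N => x; nia.
rewrite -(ler_nat R) => /le_trans; apply.
rewrite (natrM _ (27 * k ^ 4)) (natrM _ 27) (natrM _ n) !natrX.
rewrite ler_wpM2l ?mulr_ge0 ?exprn_ge0 //.
by rewrite ler_wpM2l // lerXn2r ?nnegrE // (le_trans _ m_ln).
Qed.

Lemma uniform_separation k N : (forall n, exists C, (0 < n)%N -> separation k n C) ->
  exists2 C, 0 < C & forall n, (0 < n < N)%N -> separation k n C.
Proof.
move=> sep; elim: N => [|N [C C0 IH]].
  by exists 1 => // n; rewrite ltn0 andbF.
have [C' sepN] := sep N.
exists (Num.max C C'); first by rewrite lt_max C0.
move=> n /andP[n0]; rewrite ltnS leq_eqVlt => /predU1P[E|lt_n].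
  by subst n; apply: separation_le (sepN n0); rewrite le_max lexx orbT.
by apply: separation_le (IH n _); rewrite ?n0 // le_max lexx.
Qed.

Lemma separation_all k : (0 < k)%N ->
  exists2 C, 0 < C & forall n, (0 < n)%N -> separation k n C.
Proof.
move=> k0; have [k2|k3] := leqP k 2.
  by exists 52 => // n n0; apply: low_separation.
(* Below [k * 4 ^ k] there are finitely many [n], and the largest of their constants serves them
   all. *)
have [n|C C0 sepC] := @uniform_separation k (k * 4 ^ k).
  case: n => [|n]; first by exists 0.
  suff [C sepC] : exists C, separation k n.+1 C by exists C.
  have [lt_n|le_n] := ltnP n.+1 192.
    by apply: (separation_of_hard (low_hard (ord0 : 'I_n.+1) k0 _)); rewrite lt_n orbT.
  by have [P hP] := code_hard k3 le_n; apply: separation_of_hard hP.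
exists (C + 27 * k%:R ^+ 4); first by rewrite ltr_wpDr // mulr_ge0 // exprn_ge0.
move=> n n0; have [lt_n|le_n] := ltnP n (k * 4 ^ k).
  apply: (separation_le _ (sepC n _)); last by rewrite n0.
  by rewrite lerDl mulr_ge0 // exprn_ge0.
by apply: separation_le (disj_separation k3 le_n); rewrite lerDr ltW.
Qed.
End Regimes.

Theorem theorem1p2 (R : realType) :
  exists2 c : R, 0 < c &
  forall k : nat, (0 < k)%N ->
  exists2 C : R, 0 < C &
  forall n : nat, (0 < n)%N ->
  exists P : {mpoly R[n]},
    [/\ msize P = k.+1,
        forall m : 'X_{1..n}, 0 <= P@_m,
        (1 < n)%N ->
          exists2 D : sps_circuit R n, sps_poly D = P &
            (sps_size D)%:R <= C * (n%:R * ln (n%:R : R) ^+ 2)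
      & forall D : circuit R n, monotone_circuit D -> circuit_poly D = P ->
          powR (n%:R / k%:R) (c * k%:R) <= (circuit_size D)%:R].
Proof.
exists (rate R); first by rewrite invr_gt0.
move=> k k0; have [C C0 sep] := separation_all R k0.
exists C => // n n0; have [P [size_P P_ge0 lb] ub] := sep n n0.
by exists P; split.
Qed.
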